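(* Let $h$ be a fixed positive integer and let $$S(x;h):=\sum_{1\le n\le x,\ n\neq h} d(n)\,d(n-h)\,d(n+h).$$ Then, as $x\to\infty$, $$S(x;h)\ \ge\ \frac{c_h}{27}\,x(\log x)^3+O_h\big(x(\log x)^2\big),$$ where $$c_h:=\frac{11}{8}\,f(h)\prod_{p}\Big(1-\frac1p\Big)^2\Big(1+\frac2p\Big),$$ the product running over all primes $p$, and $f$ is the multiplicative function with $f(1)=1$ and, for primes $p$ and integers $\nu\ge1$, $$f(p^\nu)=\begin{cases}\left(1+\frac4p+\frac1{p^2}-\frac{3\nu+4}{p^{\nu+1}}-\frac4{p^{\nu+2}}+\frac{3\nu+2}{p^{\nu+3}}\right)\left(1+\frac2p\right)^{-1}\left(1-\frac1p\right)^{-2}, & p>2,\\[2mm] \frac{52}{11}-\frac{41+15\nu}{11\cdot 2^{\nu}}, & p=2.\end{cases}$$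
   Context: For a nonzero integer $m$, $d(m)$ denotes the number of positive divisors of $m$ (so $d(m)=d(|m|)$). The implied constant in $O_h$ may depend on $h$. *)

(* Defs.v *)
From Stdlib Require Import Reals.
From Coquelicot Require Import Coquelicot.
From mathcomp Require Import ssreflect ssrfun ssrbool eqtype ssrnat seq div prime bigop.

Definition dnum (m : nat) : nat := size (divisors m).

(* S(x;h) = sum_{1 <= n <= x, n <> h} d(n) d(|n-h|) d(n+h) *)
Definition Ssum (h : nat) (x : R) : nat :=
  \sum_(1 <= n < (Z.to_nat (Int_part x)).+1 | n != h)
     dnum n * dnum ((n - h) + (h - n)) * dnum (n + h).

Definition fpp (p nu : nat) : R :=
  if nu == 0%N then 1%R
  else if p == 2%N then
    (52 / 11 - (41 + 15 * INR nu) / (11 * 2 ^ nu))%R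
  else
    let q := INR p in
    ((1 + 4 / q + 1 / q ^ 2 - (3 * INR nu + 4) / q ^ (nu + 1)
        - 4 / q ^ (nu + 2) + (3 * INR nu + 2) / q ^ (nu + 3))
     / (1 + 2 / q) / (1 - 1 / q) ^ 2)%R.

Definition fmul (n : nat) : R :=
  \big[Rmult/1%R]_(0 <= p < n.+1 | prime p) fpp p (logn p n).

Definition euler_partial (N : nat) : R :=
  \big[Rmult/1%R]_(0 <= p < N | prime p)
     ((1 - 1 / INR p) ^ 2 * (1 + 2 / INR p))%R.

Definition euler_prod : R := real (Lim_seq euler_partial).

Definition c_h (h : nat) : R := (11 / 8 * fmul h * euler_prod)%R.

(* Main.v *)
Require Import Defs.
From Stdlib Require Import ZArith Reals Lra Lia.
From Coquelicot Require Import Coquelicot.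
From mathcomp Require Import ssreflect ssrfun ssrbool eqtype ssrnat seq div prime bigop order.
From mathcomp Require Import zify Rstruct.

Set Implicit Arguments.
Unset Strict Implicit.
Unset Printing Implicit Defensive.

Local Open Scope R_scope.

(** Only divisors up to [y = x^(1/3)] are kept: [S(x;h)] is at least the sum over [a, b, c <= y]
    of the number of [n] with [h < n <= x], [a | n], [b | n - h], [c | n + h], which is
    [x / lcm(a,b,c) + O(1)] when the congruences are compatible.  As [y^3 <= x], the errors
    contribute [O(x)], and it remains to bound from below the sum of the densities.

    Such a density is [1/(abc)] times a product over primes [p] of a function of the valuations
    of [a, b, c].  Each local function is a finite combination of step functions
    [i' <= i, j' <= j, k' <= k], so inserting one prime turns the triple sum into a
    combination of dilated sums [F(s/p^i', t/p^j', r/p^k')].  An induction on the primes then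
    starts from a product of three harmonic sums and shows that the sum over [a, b, c <= y]
    with the conditions at primes below [N] is [K_N (log y)^3 + O((log y)^2)] uniformly in [N];
    the dilations cost a factor [(abc)^(1/4)], which keeps the product over the primes of the
    error factors convergent.  Finally [K_N] decreases to [c_h], whence the lower bound. *)

(** * Finite sums and products of real numbers *)

Notation "\rsum_ ( i <- r ) F" := (\big[Rplus/0]_(i <- r) F)
  (at level 41, F at level 41, i, r at level 50).
Notation "\rsum_ ( m <= i < n ) F" := (\big[Rplus/0]_(m <= i < n) F)
  (at level 41, F at level 41, i, m, n at level 50).
Notation "\primeprod_ ( p < n ) F" := (\big[Rmult/1]_(0 <= p < n | prime p) F)
  (at level 36, F at level 36, p, n at level 50).

Lemma rsum_le (I : eqType) (r : seq I) (F G : I -> R) :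
  (forall i, i \in r -> F i <= G i) -> \rsum_(i <- r) F i <= \rsum_(i <- r) G i.
Proof.
elim: r => [|i r IH] FG; rewrite ?big_nil ?big_cons; first by lra.
apply: Rplus_le_compat; first by apply: FG; rewrite mem_head.
by apply: IH => j jr; apply: FG; rewrite in_cons jr orbT.
Qed.

Lemma rsum_ge0 (I : Type) (r : seq I) (F : I -> R) :
  (forall i, 0 <= F i) -> 0 <= \rsum_(i <- r) F i.
Proof. by move=> F0; apply: big_ind => [|x y|i _]; [lra | lra | apply: F0]. Qed.

Lemma INR_sum (I : Type) (r : seq I) (F : I -> nat) :
  INR (\sum_(i <- r) F i) = \rsum_(i <- r) INR (F i).
Proof. exact: (big_morph INR plus_INR). Qed.

Lemma INR_expn (m n : nat) : INR (m ^ n) = INR m ^ n.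
Proof. by elim: n => [|n IH]; rewrite ?expnS ?mult_INR ?IH. Qed.

Lemma INR_andb (b c : bool) : INR (b && c) = INR b * INR c.
Proof. by rewrite -mulnb mult_INR. Qed.

Lemma INR_gt0 (n : nat) : (0 < n)%N -> 0 < INR n.
Proof. by move/ltP/lt_0_INR. Qed.

Lemma INR_neq0 (n : nat) : (0 < n)%N -> INR n <> 0.
Proof. by move/INR_gt0/Rgt_not_eq. Qed.

Lemma INR_ge1 (n : nat) : (0 < n)%N -> 1 <= INR n.
Proof. by move/leP/le_INR. Qed.

Lemma primeprodS (F : nat -> R) (n : nat) :
  \primeprod_(p < n.+1) F p = (\primeprod_(p < n) F p) * (if prime n then F n else 1).
Proof. by rewrite big_mkcond big_nat_recr //= -big_mkcond. Qed.

Lemma primeprod_ge0 (F : nat -> R) (n : nat) :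
  (forall p, prime p -> 0 <= F p) -> 0 <= \primeprod_(p < n) F p.
Proof. by move=> F0; apply: big_ind => //; [lra | apply: Rmult_le_pos]. Qed.

Lemma eq_primeprod (F G : nat -> R) (n : nat) :
  (forall p, prime p -> (p < n)%N -> F p = G p) ->
  \primeprod_(p < n) F p = \primeprod_(p < n) G p.
Proof.
move=> FG; rewrite big_nat_cond [RHS]big_nat_cond.
by apply: eq_bigr => p /andP[/andP[_ pn] pp]; apply: FG.
Qed.

Lemma primeprod_widen (F : nat -> R) (m n : nat) : (m <= n)%N ->
  (forall p, prime p -> (m <= p)%N -> F p = 1) ->
  \primeprod_(p < n) F p = \primeprod_(p < m) F p.
Proof.
move=> mn F1; rewrite (@big_cat_nat _ _ _ m) //= [X in _ * X]big_nat_cond.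
by rewrite [X in _ * X]big1 ?Rmult_1_r // => p /andP[/andP[mp _] pp]; apply: F1.
Qed.

Lemma primeprod_le_exp (F g : nat -> R) (m n : nat) : (m <= n)%N ->
  (forall p, prime p -> 0 <= F p) ->
  (forall p, (m <= p)%N -> g p.+1 <= g p) ->
  (forall p, prime p -> (m <= p)%N -> F p <= 1 + (g p - g p.+1)) ->
  \primeprod_(p < n) F p <= (\primeprod_(p < m) F p) * exp (g m - g n).
Proof.
move=> mn F0 g_decr F_le; rewrite -(subnKC mn); elim: (n - m)%N => [|d IH].
  by rewrite addn0 Rminus_diag exp_0; lra.
rewrite addnS primeprodS.
have -> : g m - g (m + d).+1 = (g m - g (m + d)%N) + (g (m + d)%N - g (m + d).+1) by ring.
rewrite exp_plus -Rmult_assoc; apply: Rmult_le_compat => //; first exact: primeprod_ge0.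
  by case: ifP => [/F0|_] //; lra.
apply: Rle_trans (exp_ineq1_le _).
case: ifP => [pp|_]; first by apply: F_le => //; apply: leq_addr.
by have := g_decr (m + d)%N (leq_addr _ _); lra.
Qed.

Lemma rsum_dvdn (s d : nat) (phi : nat -> R) : (0 < d)%N ->
  \rsum_(1 <= a < s.+1) (INR (d %| a) * phi a) =
  \rsum_(1 <= a < (s %/ d).+1) phi (d * a)%N.
Proof.
move=> d0; elim: s => [|s IH]; first by rewrite div0n !big_nil.
rewrite big_nat_recr //= IH divnS //.
case: (boolP (d %| s.+1)) => ds; last by rewrite add0n /=; lra.
rewrite add1n [RHS]big_nat_recr //=; congr (_ + _).
have -> : ((s %/ d).+1 = s.+1 %/ d)%N by rewrite divnS // ds.
by rewrite mulnC divnK // Rmult_1_l.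
Qed.

Definition sum3 (s t r : nat) (phi : nat -> nat -> nat -> R) : R :=
  \rsum_(1 <= a < s.+1) \rsum_(1 <= b < t.+1) \rsum_(1 <= c < r.+1) phi a b c.

Section Sum3.
Variables s t r : nat.
Implicit Types phi psi : nat -> nat -> nat -> R.

Lemma eq_sum3 phi psi :
  (forall a b c, (0 < a <= s)%N -> (0 < b <= t)%N -> (0 < c <= r)%N ->
     phi a b c = psi a b c) ->
  sum3 s t r phi = sum3 s t r psi.
Proof.
move=> phi_psi; apply: eq_big_nat => a a_s; apply: eq_big_nat => b b_t.
by apply: eq_big_nat => c c_r; apply: phi_psi.
Qed.

Lemma sum3_le phi psi :
  (forall a b c, (0 < a <= s)%N -> (0 < b <= t)%N -> (0 < c <= r)%N ->
     phi a b c <= psi a b c) ->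
  sum3 s t r phi <= sum3 s t r psi.
Proof.
move=> phi_psi; apply: rsum_le => a; rewrite mem_index_iota => a_s.
apply: rsum_le => b; rewrite mem_index_iota => b_t.
by apply: rsum_le => c; rewrite mem_index_iota => c_r; apply: phi_psi.
Qed.

Lemma sum3_scale x phi :
  sum3 s t r (fun a b c => x * phi a b c) = x * sum3 s t r phi.
Proof.
rewrite /sum3 big_distrr; apply: eq_bigr => a _; rewrite big_distrr.
by apply: eq_bigr => b _; rewrite big_distrr.
Qed.

Lemma sum3_add phi psi :
  sum3 s t r (fun a b c => phi a b c + psi a b c) = sum3 s t r phi + sum3 s t r psi.
Proof.
rewrite /sum3 -big_split; apply: eq_bigr => a _; rewrite -big_split.
by apply: eq_bigr => b _; rewrite -big_split.
Qed.

Lemma sum3_rsum (I : Type) (D : seq I) (phi : I -> nat -> nat -> nat -> R) :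
  sum3 s t r (fun a b c => \rsum_(u <- D) phi u a b c) =
  \rsum_(u <- D) sum3 s t r (phi u).
Proof.
rewrite /sum3 [RHS]exchange_big; apply: eq_bigr => a _ /=.
rewrite [RHS]exchange_big; apply: eq_bigr => b _ /=.
by rewrite [RHS]exchange_big.
Qed.

Lemma sum3_mul (f g k : nat -> R) :
  sum3 s t r (fun a b c => f a * g b * k c) =
  (\rsum_(1 <= a < s.+1) f a) * (\rsum_(1 <= b < t.+1) g b) *
  (\rsum_(1 <= c < r.+1) k c).
Proof.
rewrite !big_distrl; apply: eq_bigr => a _ /=.
rewrite (big_distrr (f a)) big_distrl.
by apply: eq_bigr => b _; rewrite big_distrr.
Qed.

Lemma sum3_cst x : sum3 s t r (fun _ _ _ => x) = x * (INR s * INR t * INR r).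
Proof.
have rsum1 n : \rsum_(1 <= a < n.+1) 1 = INR n.
  by elim: n => [|n IH]; rewrite ?big_nil // big_nat_recr // IH S_INR.
rewrite -!rsum1 -sum3_mul -sum3_scale; apply: eq_sum3 => a b c _ _ _; ring.
Qed.

Lemma sum3_dvdn d e f phi : (0 < d)%N -> (0 < e)%N -> (0 < f)%N ->
  sum3 s t r (fun a b c => INR (d %| a) * INR (e %| b) * INR (f %| c) * phi a b c) =
  sum3 (s %/ d) (t %/ e) (r %/ f) (fun a b c => phi (d * a) (e * b) (f * c))%N.
Proof.
move=> d0 e0 f0; rewrite /sum3.
rewrite -(rsum_dvdn s (fun a => \rsum_(1 <= b < (t %/ e).+1)
  \rsum_(1 <= c < (r %/ f).+1) phi a (e * b)%N (f * c)%N) d0).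
apply: eq_bigr => a _.
rewrite -(rsum_dvdn t (fun b => \rsum_(1 <= c < (r %/ f).+1) phi a b (f * c)%N) e0).
rewrite big_distrr; apply: eq_bigr => b _ /=.
rewrite -(rsum_dvdn r (phi a b) f0) !big_distrr; apply: eq_bigr => c _ /=; ring.
Qed.

End Sum3.

(** * Combinations of step functions *)

Definition lincomb (I : Type) (D : seq (R * I)) (f : I -> R) : R := \rsum_(u <- D) (u.1 * f u.2).

Definition lscale (I : Type) (x : R) (D : seq (R * I)) : seq (R * I) :=
  [seq (x * u.1, u.2) | u <- D].

Definition labs (I : Type) (D : seq (R * I)) : seq (R * I) := [seq (Rabs u.1, u.2) | u <- D].

Definition tensor (I J : Type) (D : seq (R * I)) (E : seq (R * J)) : seq (R * (I * J)) :=
  [seq (u.1 * v.1, (u.2, v.2)) | u <- D, v <- E].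

Section Lincomb.
Variable I : Type.
Implicit Types (D : seq (R * I)) (f g : I -> R).

Lemma lincomb_nil f : lincomb [::] f = 0.
Proof. exact: big_nil. Qed.

Lemma lincomb_cons u D f : lincomb (u :: D) f = u.1 * f u.2 + lincomb D f.
Proof. exact: big_cons. Qed.

Lemma lincomb_cat D D' f : lincomb (D ++ D') f = lincomb D f + lincomb D' f.
Proof. exact: big_cat. Qed.

Lemma lincomb_scale x D f : lincomb (lscale x D) f = x * lincomb D f.
Proof. by rewrite /lincomb big_map big_distrr; apply: eq_bigr => u _ /=; ring. Qed.

Lemma lincomb_tensor (J : Type) D (E : seq (R * J)) f (g : J -> R) :
  lincomb (tensor D E) (fun t => f t.1 * g t.2) = lincomb D f * lincomb E g.
Proof.
rewrite /lincomb big_allpairs_dep big_distrl; apply: eq_bigr => u _ /=.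
by rewrite big_distrr; apply: eq_bigr => v _ /=; ring.
Qed.

Lemma lincomb_mulr D f x : lincomb D f * x = lincomb D (fun u => f u * x).
Proof. by rewrite /lincomb big_distrl; apply: eq_bigr => u _ /=; ring. Qed.

Lemma lincomb_abs_sub_le D f g h : (forall u, Rabs (f u - g u) <= h u) ->
  Rabs (lincomb D f - lincomb D g) <= lincomb (labs D) h.
Proof.
move=> fg; elim: D => [|u D IH]; first by rewrite !lincomb_nil Rminus_diag Rabs_R0; lra.
rewrite /= !lincomb_cons /=.
have -> x x' y y' : u.1 * x + y - (u.1 * x' + y') = u.1 * (x - x') + (y - y') by ring.
apply: Rle_trans (Rabs_triang _ _) _; apply: Rplus_le_compat => //.
by rewrite Rabs_mult; apply: Rmult_le_compat_l => //; apply: Rabs_pos.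
Qed.

End Lincomb.

Local Notation steps1 := (seq (R * nat)).
Local Notation steps3 := (seq (R * (nat * nat * nat))).

Definition prod3 (f g k : nat -> R) (u : nat * nat * nat) : R := f u.1.1 * g u.1.2 * k u.2.

Definition tensor3 (A B C : steps1) : steps3 := tensor (tensor A B) C.

Lemma lincomb_tensor3 A B C f g k :
  lincomb (tensor3 A B C) (prod3 f g k) = lincomb A f * lincomb B g * lincomb C k.
Proof.
rewrite -lincomb_tensor -(lincomb_tensor (tensor A B) C (fun v => f v.1 * g v.2)).
by [].
Qed.

Definition step_at (i m : nat) : R := INR (m <= i)%N.

Definition step_fun1 (A : steps1) (i : nat) : R := lincomb A (step_at i).

Definition step_fun3 (T : steps3) (i j k : nat) : R :=
  lincomb T (prod3 (step_at i) (step_at j) (step_at k)).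

(* For [0 <= q < 1] this is [(1 - q)] times the sum over [i] of [step_fun1 A i * q ^ i]. *)
Definition mass1 (q : R) (A : steps1) : R := lincomb A (pow q).

Definition pow3 (q : R) : nat * nat * nat -> R := prod3 (pow q) (pow q) (pow q).

Definition mass3 (q : R) (T : steps3) : R := lincomb T (pow3 q).

Lemma pow3_ge0 q u : 0 <= q -> 0 <= pow3 q u.
Proof. by move=> q0; rewrite /pow3 /prod3; repeat apply: Rmult_le_pos; apply: pow_le. Qed.

Lemma mass3_cat q T U : mass3 q (T ++ U) = mass3 q T + mass3 q U.
Proof. exact: lincomb_cat. Qed.

Lemma mass3_scale q x T : mass3 q (lscale x T) = x * mass3 q T.
Proof. exact: lincomb_scale. Qed.

Lemma mass3_tensor3 q A B C : mass3 q (tensor3 A B C) = mass1 q A * mass1 q B * mass1 q C.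
Proof. exact: lincomb_tensor3. Qed.

Lemma mass3_labs_ge0 q T : 0 <= q -> 0 <= mass3 q (labs T).
Proof.
move=> q0; rewrite /mass3 /lincomb big_map; apply: rsum_ge0 => u /=.
by apply: Rmult_le_pos; [apply: Rabs_pos | apply: pow3_ge0].
Qed.

Lemma step_fun3_cat T U i j k : step_fun3 (T ++ U) i j k = step_fun3 T i j k + step_fun3 U i j k.
Proof. exact: lincomb_cat. Qed.

Lemma step_fun3_scale x T i j k : step_fun3 (lscale x T) i j k = x * step_fun3 T i j k.
Proof. exact: lincomb_scale. Qed.

Lemma step_fun3_tensor3 A B C i j k :
  step_fun3 (tensor3 A B C) i j k = step_fun1 A i * step_fun1 B j * step_fun1 C k.
Proof. exact: lincomb_tensor3. Qed.

(** * Local densities *)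

Definition max3 (i j k : nat) : nat := maxn (maxn i j) k.

Definition local_compatible (nu mu i j k : nat) : bool :=
  [&& minn i j <= nu, minn i k <= nu & minn j k <= mu]%N.

(* With [q = 1/p], this is [p^(i+j+k)] times the density of the integers [n] such that [p^i | n],
   [p^j | n - h] and [p^k | n + h], where [nu] and [mu] are the valuations of [h] and [2h]. *)
Definition local_weight (q : R) (nu mu i j k : nat) : R :=
  INR (local_compatible nu mu i j k) * q ^ max3 i j k * (/ q) ^ (i + j + k).

Section LocalSteps.
Variable q : R.
Hypothesis q_gt0 : 0 < q.

Fixpoint trunc_steps (n : nat) : steps1 :=
  if n is m.+1 then trunc_steps m ++ lscale ((/ q) ^ m) [:: (1, m); (-1, m.+1)] else [::].

Definition capped_steps (n : nat) : steps1 :=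
  lscale (q ^ n) (trunc_steps n) ++ [:: (1, n)].

Fixpoint gap_steps (n : nat) : steps3 :=
  if n is m.+1 then
    gap_steps m ++
    lscale (q ^ m * (1 - q)) (tensor3 (trunc_steps n) (trunc_steps n) (trunc_steps n))
  else [::].

Lemma inv_pow_mul_pow n : (/ q) ^ n * q ^ n = 1.
Proof. by rewrite -Rpow_mult_distr Rinv_l ?pow1 //; lra. Qed.

Lemma step_fun1_trunc_steps n i : step_fun1 (trunc_steps n) i = (/ q) ^ i * INR (i < n)%N.
Proof.
elim: n => [|n IH]; first by rewrite /step_fun1 lincomb_nil ltn0 Rmult_0_r.
rewrite /step_fun1 lincomb_cat -/(step_fun1 _ i) IH lincomb_scale.
rewrite !lincomb_cons lincomb_nil /step_at ltnS.
by case: ltngtP => [ni|ni|<-] /=; lra.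
Qed.

Lemma mass1_trunc_steps n : mass1 q (trunc_steps n) = INR n * (1 - q).
Proof.
elim: n => [|n IH]; first by rewrite /mass1 lincomb_nil /=; ring.
rewrite /mass1 lincomb_cat -/(mass1 q _) IH lincomb_scale !lincomb_cons lincomb_nil /=.
transitivity (INR n * (1 - q) + (/ q) ^ n * q ^ n * (1 - q)); first by ring.
by rewrite inv_pow_mul_pow -/(INR n.+1) S_INR; ring.
Qed.

Lemma step_fun1_capped_steps n i : step_fun1 (capped_steps n) i = (/ q) ^ i * q ^ maxn i n.
Proof.
rewrite /step_fun1 lincomb_cat lincomb_scale -/(step_fun1 _ i) step_fun1_trunc_steps.
rewrite lincomb_cons lincomb_nil /step_at.
by case: ltnP => ni /=; rewrite ?inv_pow_mul_pow; ring.
Qed.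

Lemma mass1_capped_steps n : mass1 q (capped_steps n) = q ^ n * (INR n * (1 - q) + 1).
Proof.
rewrite /mass1 lincomb_cat lincomb_scale -/(mass1 q _) mass1_trunc_steps.
by rewrite lincomb_cons lincomb_nil /=; ring.
Qed.

Lemma step_fun3_gap_steps n i j k :
  step_fun3 (gap_steps n) i j k =
  (q ^ max3 i j k - q ^ maxn (max3 i j k) n) * (/ q) ^ (i + j + k).
Proof.
elim: n => [|n IH] /=; first by rewrite /step_fun3 lincomb_nil maxn0; ring.
rewrite step_fun3_cat IH step_fun3_scale step_fun3_tensor3 -/(trunc_steps n.+1).
rewrite !step_fun1_trunc_steps.
transitivity ((q ^ max3 i j k - q ^ maxn (max3 i j k) n +
  q ^ n * (1 - q) * INR [&& i < n.+1, j < n.+1 & k < n.+1]%N) * (/ q) ^ (i + j + k)).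
  by rewrite !INR_andb !pow_add; ring.
have -> : [&& i < n.+1, j < n.+1 & k < n.+1]%N = (max3 i j k < n.+1)%N.
  by rewrite /max3 !gtn_max andbA.
case: (ltnP (max3 i j k) n.+1) => max_n.
  by rewrite (maxn_idPr _) //=; ring.
by rewrite (maxn_idPl _) ?(ltnW max_n) //=; ring.
Qed.

Definition gap_mass (n : nat) : R :=
  \rsum_(0 <= m < n) (q ^ m * (1 - q) * (INR m.+1 * (1 - q)) ^ 3).

Lemma gap_mass0 : gap_mass 0 = 0.
Proof. exact: big_nil. Qed.

Lemma gap_massS n :
  gap_mass n.+1 = gap_mass n + q ^ n * (1 - q) * (INR n.+1 * (1 - q)) ^ 3.
Proof. by rewrite /gap_mass big_nat_recr. Qed.

Lemma gap_mass_ge0 n : q <= 1 -> 0 <= gap_mass n.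
Proof.
move=> q1; apply: rsum_ge0 => m; apply: Rmult_le_pos.
  by apply: Rmult_le_pos; [apply: pow_le | ]; lra.
by apply: pow_le; apply: Rmult_le_pos; [apply: pos_INR | lra].
Qed.

Lemma mass3_gap_steps n : mass3 q (gap_steps n) = gap_mass n.
Proof.
elim: n => [|n IH]; first by rewrite gap_mass0; apply: big_nil.
by rewrite mass3_cat mass3_scale mass3_tensor3 IH !mass1_trunc_steps gap_massS; ring.
Qed.

(* The integers [n] are split according to their [p]-adic valuation.  Below [nu] they contribute
   [gap_steps]; otherwise, with [h = p^nu u], the number [n / p^nu] either avoids the classes
   [0, u, -u] modulo [p] or lies in exactly one of them. *)
Definition odd_steps (nu : nat) : steps3 :=
  let A := trunc_steps nu.+1 in let B := capped_steps nu.+1 in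
  gap_steps nu ++ lscale (q ^ nu * (1 - 3 * q)) (tensor3 A A A) ++
  tensor3 B A A ++ tensor3 A B A ++ tensor3 A A B.

Lemma step_fun3_odd_steps nu i j k : step_fun3 (odd_steps nu) i j k = local_weight q nu nu i j k.
Proof.
rewrite !step_fun3_cat step_fun3_scale !step_fun3_tensor3 step_fun3_gap_steps.
rewrite !step_fun1_trunc_steps !step_fun1_capped_steps /local_weight /local_compatible !geq_min.
rewrite !pow_add -!(ltnS _ nu).
case: (ltnP i nu.+1) => i_nu; case: (ltnP j nu.+1) => j_nu; case: (ltnP k nu.+1) => k_nu /=.
- have -> : maxn (max3 i j k) nu = nu by rewrite /max3; lia.
  by ring.
all: have -> : maxn (max3 i j k) nu = max3 i j k by rewrite /max3; lia.
all: first [ring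
  | rewrite (_ : max3 i j k = i); [ring | rewrite /max3; lia]
  | rewrite (_ : max3 i j k = j); [ring | rewrite /max3; lia]
  | rewrite (_ : max3 i j k = k); [ring | rewrite /max3; lia]].
Qed.

Lemma mass3_odd_steps nu :
  mass3 q (odd_steps nu) =
  gap_mass nu + q ^ nu * (1 - 3 * q) * (INR nu.+1 * (1 - q)) ^ 3 +
  3 * (q ^ nu.+1 * (INR nu.+1 * (1 - q) + 1)) * (INR nu.+1 * (1 - q)) ^ 2.
Proof.
rewrite !mass3_cat mass3_scale !mass3_tensor3 mass3_gap_steps.
by rewrite !mass1_trunc_steps !mass1_capped_steps; ring.
Qed.

Lemma mass3_odd_steps_closed nu :
  mass3 q (odd_steps nu) =
  1 + 4 * q + q ^ 2 - (3 * INR nu + 4) * q ^ (nu + 1) - 4 * q ^ (nu + 2)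
  + (3 * INR nu + 2) * q ^ (nu + 3).
Proof.
have gap_massE : gap_mass nu =
    1 + 4 * q + q ^ 2 - (3 * INR nu + 4) * q ^ (nu + 1) - 4 * q ^ (nu + 2)
    + (3 * INR nu + 2) * q ^ (nu + 3)
    - q ^ nu * (1 - 3 * q) * (INR nu.+1 * (1 - q)) ^ 3
    - 3 * (q ^ nu.+1 * (INR nu.+1 * (1 - q) + 1)) * (INR nu.+1 * (1 - q)) ^ 2.
  elim: nu => [|nu IH]; first by rewrite gap_mass0 /=; ring.
  by rewrite gap_massS IH !S_INR !pow_add /=; ring.
by rewrite mass3_odd_steps gap_massE; ring.
Qed.

Lemma mass3_odd_steps_ge0 nu : 3 * q <= 1 -> 0 <= mass3 q (odd_steps nu).
Proof.
move=> q3; have : 0 <= INR nu.+1 * (1 - q).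
  by apply: Rmult_le_pos; [apply: pos_INR | lra].
rewrite mass3_odd_steps; move: (INR nu.+1 * (1 - q)) => x x0.
repeat apply: Rplus_le_le_0_compat.
- by apply: gap_mass_ge0; lra.
- by repeat apply: Rmult_le_pos; try apply: pow_le; lra.
- by repeat apply: Rmult_le_pos; try apply: pow_le; lra.
Qed.

End LocalSteps.

(* As above for [p = 2], where [u] is odd: [n / 2^nu] is even, or congruent to [u], or
   congruent to [-u] modulo [4]. *)
Definition even_steps (nu : nat) : steps3 :=
  let A := trunc_steps (/ 2) nu.+1 in let B := capped_steps (/ 2) nu.+1 in
  let A' := trunc_steps (/ 2) nu.+2 in let B' := capped_steps (/ 2) nu.+2 in
  gap_steps (/ 2) nu ++ tensor3 B A A ++ tensor3 A B' A' ++ tensor3 A A' B'.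

Lemma step_fun3_even_steps nu i j k :
  step_fun3 (even_steps nu) i j k = local_weight (/ 2) nu nu.+1 i j k.
Proof.
have half_gt0 : 0 < / 2 by lra.
rewrite !step_fun3_cat !step_fun3_tensor3 !step_fun3_gap_steps //.
rewrite !step_fun1_trunc_steps !step_fun1_capped_steps // /local_weight /local_compatible.
rewrite !geq_min !pow_add -!(ltnS _ nu) -(ltnS j nu.+1) -(ltnS k nu.+1).
case: (ltnP i nu.+1) => i_nu; last first.
  have -> : maxn (max3 i j k) nu = max3 i j k by rewrite /max3; lia.
  case: (ltnP j nu.+1) => j_nu; case: (ltnP k nu.+1) => k_nu /=; try ring.
  have -> : max3 i j k = i by rewrite /max3; lia.
  by rewrite (leqW j_nu) /=; ring.
case: (ltnP j nu.+2) => j_nu; last first.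
  have -> : maxn (max3 i j k) nu = max3 i j k by rewrite /max3; lia.
  have -> : (j < nu.+1)%N = false by lia.
  case: (ltnP k nu.+2) => k_nu /=; last by ring.
  have -> : max3 i j k = j by rewrite /max3; lia.
  by ring.
case: (ltnP k nu.+2) => k_nu; last first.
  have -> : maxn (max3 i j k) nu = max3 i j k by rewrite /max3; lia.
  have -> : (k < nu.+1)%N = false by lia.
  have -> : max3 i j k = k by rewrite /max3; lia.
  by rewrite /=; ring.
case: (ltnP j nu.+1) => j_nu'; case: (ltnP k nu.+1) => k_nu' /=.
  have -> : maxn (max3 i j k) nu = nu by rewrite /max3; lia.
  by field.
all: have -> : maxn (max3 i j k) nu = max3 i j k by rewrite /max3; lia.
all: have -> : max3 i j k = nu.+1 by rewrite /max3; lia.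
all: by rewrite /=; field.
Qed.

Lemma mass3_even_steps nu :
  mass3 (/ 2) (even_steps nu) =
  gap_mass (/ 2) nu + (/ 2) ^ nu.+1 * (INR nu.+1 / 2 + 1) * (INR nu.+1 / 2) ^ 2 +
  (/ 2) ^ nu.+1 * (INR nu.+2 / 2 + 1) * (INR nu.+1 / 2) * (INR nu.+2 / 2).
Proof.
have half_gt0 : 0 < / 2 by lra.
rewrite !mass3_cat !mass3_tensor3 mass3_gap_steps //.
by rewrite !mass1_trunc_steps // !mass1_capped_steps //=; field.
Qed.

Lemma mass3_even_steps_closed nu :
  mass3 (/ 2) (even_steps nu) = 52 / 16 - (41 + 15 * INR nu) / 16 * (/ 2) ^ nu.
Proof.
have gap_massE : gap_mass (/ 2) nu =
    52 / 16 - (41 + 15 * INR nu) / 16 * (/ 2) ^ nu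
    - (/ 2) ^ nu.+1 * (INR nu.+1 / 2 + 1) * (INR nu.+1 / 2) ^ 2
    - (/ 2) ^ nu.+1 * (INR nu.+2 / 2 + 1) * (INR nu.+1 / 2) * (INR nu.+2 / 2).
  elim: nu => [|nu IH]; first by rewrite gap_mass0 /=; field.
  by rewrite gap_massS IH !S_INR /=; field.
by rewrite mass3_even_steps gap_massE; ring.
Qed.

Lemma mass3_even_steps_ge0 nu : 0 <= mass3 (/ 2) (even_steps nu).
Proof.
have nu0 := pos_INR nu; rewrite mass3_even_steps !S_INR.
repeat apply: Rplus_le_le_0_compat.
- by apply: gap_mass_ge0; lra.
- by repeat apply: Rmult_le_pos; try apply: pow_le; lra.
- by repeat apply: Rmult_le_pos; try apply: pow_le; lra.
Qed.

(* At primes not dividing [2h] at most one exponent is positive.  Inclusion-exclusion on the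
   pairs of exponents has no term of degree one, so that the products over the primes of the
   absolute masses of [coprime_steps] converge, unlike those of [odd_steps 0]. *)
Definition coprime_steps : steps3 :=
  [:: (1, (0, 0, 0)%N); (-1, (1, 1, 0)%N); (-1, (1, 0, 1)%N); (-1, (0, 1, 1)%N);
      (2, (1, 1, 1)%N)].

Lemma step_fun3_coprime_steps q i j k : 0 < q ->
  step_fun3 coprime_steps i j k = local_weight q 0 0 i j k.
Proof.
move=> q0; have -> : local_weight q 0 0 i j k = INR (local_compatible 0 0 i j k).
  rewrite /local_weight; have [cpt|_] := boolP (local_compatible 0 0 i j k); last first.
    by rewrite /=; ring.
  have -> : max3 i j k = (i + j + k)%N by move: cpt; rewrite /local_compatible /max3; lia.
  by rewrite Rmult_assoc [_ ^ _ * _]Rmult_comm inv_pow_mul_pow // Rmult_1_r.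
rewrite /step_fun3 !lincomb_cons lincomb_nil /prod3 /step_at /local_compatible !geq_min !leqn0.
by case: i => [|i]; case: j => [|j]; case: k => [|k]; rewrite /=; lra.
Qed.

Lemma mass3_coprime_steps q : mass3 q coprime_steps = (1 - q) ^ 2 * (1 + 2 * q).
Proof. by rewrite /mass3 !lincomb_cons lincomb_nil /pow3 /prod3 /=; ring. Qed.

Lemma mass3_labs_coprime_steps w : 0 <= w <= 1 -> mass3 w (labs coprime_steps) <= 1 + 5 * w ^ 2.
Proof.
move=> w01; have -> : mass3 w (labs coprime_steps) = 1 + 3 * w ^ 2 + 2 * w ^ 3.
  rewrite /mass3 /labs /= !lincomb_cons lincomb_nil /pow3 /prod3 /= Rabs_m1 Rabs_R1.
  by rewrite (Rabs_pos_eq 2); [ring | lra].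
nra.
Qed.

Definition local_steps (p nu : nat) : steps3 :=
  if p == 2%N then even_steps nu
  else if nu == 0%N then coprime_steps
  else odd_steps (/ INR p) nu.

Definition euler_factor (p : nat) : R := (1 - 1 / INR p) ^ 2 * (1 + 2 / INR p).

Lemma inv_prime_le_half p : prime p -> 0 < / INR p <= / 2.
Proof.
move=> /prime_gt1/leP/le_INR /= p2.
split; first by apply: Rinv_0_lt_compat; lra.
by apply: Rinv_le_contravar; lra.
Qed.

Lemma euler_factor_bounds p : prime p -> 0 < euler_factor p <= 1.
Proof.
move=> /inv_prime_le_half; rewrite /euler_factor /Rdiv !Rmult_1_l; move: (/ INR p) => q q02.
split; last by nra.
by apply: Rmult_lt_0_compat; [apply: pow_lt |]; lra.
Qed.

Lemma INR_odd_prime_ge3 p : prime p -> p != 2%N -> 3 <= INR p.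
Proof.
move=> /prime_gt1 p1 p2; have /leP/le_INR : (3 <= p)%N by lia.
by rewrite /=; lra.
Qed.

Lemma step_fun3_local_steps p nu i j k : prime p ->
  step_fun3 (local_steps p nu) i j k = local_weight (/ INR p) nu (logn p 2 + nu) i j k.
Proof.
move=> pp; rewrite /local_steps; have [->|p2] := eqVneq p 2%N.
  by rewrite step_fun3_even_steps logn_prime.
have [q0 _] := inv_prime_le_half pp; rewrite logn_prime // (negbTE p2) add0n.
by case: eqP => [->|_]; [apply: step_fun3_coprime_steps | apply: step_fun3_odd_steps].
Qed.

Lemma mass3_local_steps p nu : prime p ->
  mass3 (/ INR p) (local_steps p nu) =
  (if p == 2%N then 11 / 8 else 1) * fpp p nu * euler_factor p.
Proof.
move=> pp; rewrite /local_steps /fpp /euler_factor; have [p0 _] := inv_prime_le_half pp.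
have [->|p2] := eqVneq p 2%N.
  rewrite mass3_even_steps_closed pow_inv /=.
  by case: eqP => [->|_] /=; field; apply: pow_nonzero; lra.
case: eqP => _; first by rewrite mass3_coprime_steps /Rdiv; ring.
rewrite mass3_odd_steps_closed // !pow_add !pow_inv.
have p3 := INR_odd_prime_ge3 pp p2.
by field; repeat split; try apply: pow_nonzero; lra.
Qed.

Lemma mass3_local_steps_ge0 p nu : prime p -> 0 <= mass3 (/ INR p) (local_steps p nu).
Proof.
move=> pp; have [q0 q2] := inv_prime_le_half pp.
rewrite /local_steps; have [->|p2] := eqVneq p 2%N; first exact: mass3_even_steps_ge0.
case: eqP => _; first by rewrite mass3_coprime_steps; apply: Rmult_le_pos; [apply: pow_le|]; lra.
apply: mass3_odd_steps_ge0 => //; have p3 := INR_odd_prime_ge3 pp p2.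
by apply/Rle_div_l; lra.
Qed.

Lemma fpp_ge0 p nu : prime p -> 0 <= fpp p nu.
Proof.
move=> pp; have [euler_gt0 _] := euler_factor_bounds pp.
have := mass3_local_steps_ge0 nu pp; rewrite mass3_local_steps // => mass_ge0.
apply: (Rmult_le_reg_r (euler_factor p)) => //; rewrite Rmult_0_l.
apply: (Rmult_le_reg_l (if p == 2%N then 11 / 8 else 1)); first by case: ifP; lra.
by rewrite Rmult_0_r -Rmult_assoc.
Qed.

Definition divisor_steps (h p : nat) : steps3 := local_steps p (logn p h).

(** * Sums over triples of weights given by local step functions *)

Definition root4 (a : nat) : R := sqrt (sqrt (INR a)).

Lemma root4M a b : root4 (a * b) = root4 a * root4 b.
Proof. by rewrite /root4 mult_INR !sqrt_mult //; try apply: sqrt_pos; apply: pos_INR. Qed.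

Lemma root4X a n : root4 (a ^ n) = root4 a ^ n.
Proof. by elim: n => [|n IH]; rewrite ?expnS ?root4M ?IH // /root4 /= !sqrt_1. Qed.

Lemma root4_ge0 a : 0 <= root4 a.
Proof. exact: sqrt_pos. Qed.

Lemma root4_ge1 a : (0 < a)%N -> 1 <= root4 a.
Proof.
move=> /INR_ge1 a1; rewrite /root4 -sqrt_1 -{1}sqrt_1.
by do 2!apply: sqrt_le_1_alt.
Qed.

Lemma root4_pow4 a : root4 a ^ 4 = INR a.
Proof.
transitivity ((root4 a ^ 2) ^ 2); first by ring.
by rewrite /root4 !pow2_sqrt //; [apply: pos_INR | apply: sqrt_pos].
Qed.

Lemma ln_le_sub1 x : 0 < x -> ln x <= x - 1.
Proof. by move=> x0; have := exp_ineq1_le (ln x); rewrite exp_ln //; lra. Qed.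

Lemma ln_INR_ge0 n : (0 < n)%N -> 0 <= ln (INR n).
Proof. by move=> /INR_ge1 n1; rewrite -ln_1; apply: ln_le; lra. Qed.

Lemma one_plus_ln_le_root4 a : (0 < a)%N -> 1 + ln (INR a) <= 4 * root4 a.
Proof.
move=> /root4_ge1 a1; rewrite -root4_pow4 ln_pow; last by lra.
by have := @ln_le_sub1 (root4 a) ltac:(lra); rewrite /=; lra.
Qed.

Definition harmonic_sum (s : nat) : R := \rsum_(1 <= a < s.+1) / INR a.

Lemma harmonic_sumS s : harmonic_sum s.+1 = harmonic_sum s + / INR s.+1.
Proof. by rewrite /harmonic_sum big_nat_recr. Qed.

Lemma ln_INR_S_le_harmonic_sum s : ln (INR s.+1) <= harmonic_sum s.
Proof.
elim: s => [|s IH]; first by rewrite /harmonic_sum big_nil ln_1; lra.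
have s0 : 0 < INR s.+1 by apply: INR_gt0.
have s1 : 0 < INR s.+2 by apply: INR_gt0.
have := ln_le_sub1 (Rdiv_lt_0_compat _ _ s1 s0); rewrite harmonic_sumS ln_div //.
have -> : INR s.+2 / INR s.+1 - 1 = / INR s.+1 by rewrite [INR s.+2]S_INR; field; lra.
by lra.
Qed.

Lemma harmonic_sum_le_ln s : (0 < s)%N -> harmonic_sum s <= 1 + ln (INR s).
Proof.
case: s => // s _; elim: s => [|s IH]; first by rewrite /harmonic_sum big_nat1 /= ln_1; lra.
have s0 : 0 < INR s.+1 by apply: INR_gt0.
have s1 : 0 < INR s.+2 by apply: INR_gt0.
have := ln_le_sub1 (Rdiv_lt_0_compat _ _ s0 s1); rewrite harmonic_sumS ln_div //.
have -> : INR s.+1 / INR s.+2 - 1 = - / INR s.+2.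
  by move: s1; rewrite [INR s.+2]S_INR => ?; field; lra.
by lra.
Qed.

Lemma harmonic_sum_divn_bounds y a : (0 < y)%N -> (0 < a)%N ->
  0 <= harmonic_sum (y %/ a) <= 1 + ln (INR y).
Proof.
move=> y0 a0; split.
  by apply: Rle_trans (ln_INR_S_le_harmonic_sum _); apply: ln_INR_ge0.
have ly := ln_INR_ge0 y0; have [->|] := eqVneq (y %/ a)%N 0%N.
  by rewrite /harmonic_sum big_nil; lra.
rewrite -lt0n => q0; apply: Rle_trans (harmonic_sum_le_ln q0) _.
apply: Rplus_le_compat_l; apply: ln_le; first exact: INR_gt0.
by apply: le_INR; apply/leP; apply: leq_div.
Qed.

Lemma harmonic_sum_divn_approx y a : (0 < y)%N -> (0 < a)%N ->
  Rabs (harmonic_sum (y %/ a) - ln (INR y)) <= 1 + ln (INR a).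
Proof.
move=> y0 a0; have la := ln_INR_ge0 a0; have [_ upper] := harmonic_sum_divn_bounds y0 a0.
have lower : ln (INR y) - ln (INR a) <= harmonic_sum (y %/ a).
  have A0 := INR_gt0 a0; have Y0 := INR_gt0 y0.
  apply: Rle_trans (ln_INR_S_le_harmonic_sum _); rewrite -ln_div //.
  apply: ln_le; first exact: Rdiv_lt_0_compat.
  apply/Rle_div_l => //; rewrite -mult_INR; apply: le_INR; apply/leP.
  exact: ltnW (ltn_ceil y a0).
by split_Rabs; lra.
Qed.

Lemma Rabs_mul3_sub_cube_le (x y z l A B C M : R) :
  0 <= l <= M -> 0 <= y <= M -> 0 <= z <= M ->
  Rabs (x - l) <= A -> Rabs (y - l) <= B -> Rabs (z - l) <= C ->
  Rabs (x * y * z - l ^ 3) <= (A + B + C) * M ^ 2.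
Proof.
move=> lM yM zM xA yB zC.
have mul2 u v w D : 0 <= v <= M -> 0 <= w <= M -> Rabs u <= D -> Rabs (u * (v * w)) <= D * M ^ 2.
  move=> vM wM uD; have vw0 : 0 <= v * w by apply: Rmult_le_pos; lra.
  rewrite Rabs_mult (Rabs_pos_eq (v * w)) //; apply: Rmult_le_compat => //; first exact: Rabs_pos.
  by rewrite /= Rmult_1_r; apply: Rmult_le_compat; lra.
have -> : x * y * z - l ^ 3 = (x - l) * (y * z) + ((y - l) * (l * z) + (z - l) * (l * l)) by ring.
have := mul2 _ _ _ _ yM zM xA; have := mul2 _ _ _ _ lM zM yB; have := mul2 _ _ _ _ lM lM zC.
have := Rabs_triang ((x - l) * (y * z)) ((y - l) * (l * z) + (z - l) * (l * l)).
by have := Rabs_triang ((y - l) * (l * z)) ((z - l) * (l * l)); lra.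
Qed.

Lemma harmonic_sum_mul3_approx y a b c : (0 < y)%N -> (0 < a)%N -> (0 < b)%N -> (0 < c)%N ->
  Rabs (harmonic_sum (y %/ a) * harmonic_sum (y %/ b) * harmonic_sum (y %/ c) -
        ln (INR y) ^ 3) <=
  12 * (root4 a * root4 b * root4 c) * (1 + ln (INR y)) ^ 2.
Proof.
move=> y0 a0 b0 c0; have ly := ln_INR_ge0 y0.
apply: Rle_trans (Rabs_mul3_sub_cube_le (A := 4 * root4 a) (B := 4 * root4 b) (C := 4 * root4 c)
                    (M := 1 + ln (INR y)) _ _ _ _ _ _) _.
- by lra.
- exact: harmonic_sum_divn_bounds.
- exact: harmonic_sum_divn_bounds.
- exact: Rle_trans (harmonic_sum_divn_approx y0 a0) (one_plus_ln_le_root4 a0).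
- exact: Rle_trans (harmonic_sum_divn_approx y0 b0) (one_plus_ln_le_root4 b0).
- exact: Rle_trans (harmonic_sum_divn_approx y0 c0) (one_plus_ln_le_root4 c0).
apply: Rmult_le_compat_r; first by apply: pow_le; lra.
have A1 := root4_ge1 a0; have B1 := root4_ge1 b0; have C1 := root4_ge1 c0.
have : 1 <= root4 a * root4 b by nra.
have : 1 <= root4 a * root4 c by nra.
have : 1 <= root4 b * root4 c by nra.
nra.
Qed.

Section TripleSum.
Variable T : nat -> steps3.

Definition triple_weight (N a b c : nat) : R :=
  (\primeprod_(p < N) step_fun3 (T p) (logn p a) (logn p b) (logn p c)) *
  (/ INR a * / INR b * / INR c).

Definition triple_sum (N s t r : nat) : R := sum3 s t r (triple_weight N).

Lemma triple_weight_pfactor N i j k a b c : prime N ->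
  triple_weight N (N ^ i * a) (N ^ j * b) (N ^ k * c) =
  pow3 (/ INR N) (i, j, k) * triple_weight N a b c.
Proof.
move=> pN; rewrite /triple_weight.
rewrite (@eq_primeprod _ (fun p => step_fun3 (T p) (logn p a) (logn p b) (logn p c))).
  by rewrite !mult_INR !INR_expn !Rinv_mult -!pow_inv /pow3 /prod3 /=; ring.
move=> p pp ltpN; rewrite !logn_Gauss // coprimeXr // prime_coprime // dvdn_prime2 //.
all: by rewrite ltn_eqF.
Qed.

Lemma triple_sum_prime N s t r : prime N ->
  triple_sum N.+1 s t r =
  lincomb (T N) (fun u =>
    pow3 (/ INR N) u * triple_sum N (s %/ N ^ u.1.1) (t %/ N ^ u.1.2) (r %/ N ^ u.2)).
Proof.
move=> pN; have N0 i : (0 < N ^ i)%N by rewrite expn_gt0 prime_gt0.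
transitivity (sum3 s t r (fun a b c => \rsum_(u <- T N) (u.1 *
    (INR (N ^ u.2.1.1 %| a) * INR (N ^ u.2.1.2 %| b) * INR (N ^ u.2.2 %| c) *
     triple_weight N a b c)))).
  apply: eq_sum3 => a b c /andP[a0 _] /andP[b0 _] /andP[c0 _].
  rewrite /triple_weight primeprodS pN /step_fun3 /lincomb big_distrr big_distrl.
  by apply: eq_bigr => u _ /=; rewrite /prod3 /step_at !pfactor_dvdn //; ring.
rewrite sum3_rsum; apply: eq_bigr => u _; rewrite sum3_scale sum3_dvdn //.
congr (_ * _); rewrite /triple_sum -sum3_scale; apply: eq_sum3 => a b c _ _ _.
by case: (u.2) => [[i j] k]; apply: triple_weight_pfactor.
Qed.

Lemma triple_sum_nonprime N s t r : ~~ prime N -> triple_sum N.+1 s t r = triple_sum N s t r.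
Proof.
move=> pN; apply: eq_sum3 => a b c _ _ _.
by rewrite /triple_weight primeprodS (negbTE pN) Rmult_1_r.
Qed.

Definition triple_mass (N : nat) : R := \primeprod_(p < N) mass3 (/ INR p) (T p).

Definition triple_error (N : nat) : R :=
  \primeprod_(p < N) mass3 (root4 p / INR p) (labs (T p)).

(* Induction on [N]: inserting a prime [p] replaces the sum by a combination of sums with the
   ranges divided by powers of [p], at the cost of a factor [root4 p] for each factor [p]. *)
Lemma triple_sum_approx N y a b c : (0 < y)%N -> (0 < a)%N -> (0 < b)%N -> (0 < c)%N ->
  Rabs (triple_sum N (y %/ a) (y %/ b) (y %/ c) - triple_mass N * ln (INR y) ^ 3) <=
  12 * triple_error N * (root4 a * root4 b * root4 c) * (1 + ln (INR y)) ^ 2.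
Proof.
move=> y0; elim: N a b c => [|N IH] a b c a0 b0 c0.
  have -> s t r : triple_sum 0 s t r = harmonic_sum s * harmonic_sum t * harmonic_sum r.
    rewrite /triple_sum -sum3_mul; apply: eq_sum3 => a' b' c' _ _ _.
    by rewrite /triple_weight big_geq // Rmult_1_l.
  rewrite /triple_mass /triple_error !big_geq // Rmult_1_l Rmult_1_r.
  exact: harmonic_sum_mul3_approx.
rewrite /triple_mass /triple_error !primeprodS -/(triple_mass N) -/(triple_error N).
have [pN|pN] := boolP (prime N); last by rewrite triple_sum_nonprime // !Rmult_1_r; apply: IH.
have N0 : 0 < / INR N by have [] := inv_prime_le_half pN.
have -> : triple_mass N * mass3 (/ INR N) (T N) * ln (INR y) ^ 3 =
    mass3 (/ INR N) (T N) * (triple_mass N * ln (INR y) ^ 3) by ring.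
have -> : 12 * (triple_error N * mass3 (root4 N / INR N) (labs (T N))) *
      (root4 a * root4 b * root4 c) * (1 + ln (INR y)) ^ 2 =
    mass3 (root4 N / INR N) (labs (T N)) *
      (12 * triple_error N * (root4 a * root4 b * root4 c) * (1 + ln (INR y)) ^ 2) by ring.
rewrite triple_sum_prime // /mass3 !lincomb_mulr.
apply: lincomb_abs_sub_le => -[[i j] k] /=; rewrite -!divnMA -Rmult_minus_distr_l Rabs_mult.
have pow_N_ge0 : 0 <= pow3 (/ INR N) (i, j, k) by apply: pow3_ge0; lra.
rewrite Rabs_pos_eq //.
have {}IH := IH (a * N ^ i)%N (b * N ^ j)%N (c * N ^ k)%N.
apply: Rle_trans (Rmult_le_compat_l _ _ _ _ (IH _ _ _)) _.
- by [].
1-3: by rewrite muln_gt0 ?a0 ?b0 ?c0 expn_gt0 prime_gt0.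
apply: Req_le; rewrite !root4M !root4X /pow3 /prod3 /= /Rdiv !Rpow_mult_distr; ring.
Qed.

End TripleSum.

(** * The weight of a triple of divisors *)

Definition lcm3 (a b c : nat) : nat := lcmn (lcmn a b) c.

Lemma lcm3_gt0 a b c : (0 < a)%N -> (0 < b)%N -> (0 < c)%N -> (0 < lcm3 a b c)%N.
Proof. by move=> a0 b0 c0; rewrite !lcmn_gt0 a0 b0 c0. Qed.

Lemma logn_lcm3 p a b c : (0 < a)%N -> (0 < b)%N -> (0 < c)%N ->
  logn p (lcm3 a b c) = max3 (logn p a) (logn p b) (logn p c).
Proof. by move=> a0 b0 c0; rewrite /lcm3 !logn_lcm ?lcmn_gt0 ?a0. Qed.

(* The condition for [a | n], [b | n - h], [c | n + h] to have a common solution [n]. *)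
Definition compatible (h a b c : nat) : bool :=
  [&& gcdn a b %| h, gcdn a c %| h & gcdn b c %| 2 * h].

Lemma primeprod_logn n N : (0 < n < N)%N -> \primeprod_(p < N) INR p ^ logn p n = INR n.
Proof.
case: N => [|N] /andP[n0 nN] //.
rewrite -[in RHS](partnT n0) (@widen_partn N) // (big_morph INR mult_INR (erefl _)).
rewrite big_mkcond; apply: eq_bigr => p _; rewrite INR_expn.
by case: (boolP (prime p)) => // pp; rewrite lognE (negbTE pp).
Qed.

Lemma primeprod_logn_le m d N : (0 < m < N)%N -> (0 < d)%N ->
  \primeprod_(p < N) INR (logn p m <= logn p d)%N = INR (m %| d).
Proof.
move=> /andP[m0 mN] d0.
rewrite -(big_morph (fun b : bool => INR b) INR_andb (erefl : INR true = 1)).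
rewrite big_all_cond; congr (INR (nat_of_bool _)); apply/allP/idP => [log_le|md p _ /=].
  apply/dvdn_partP => // p; rewrite mem_primes => /and3P[pp _ pm].
  rewrite p_part pfactor_dvdn //; apply: (implyP (log_le p _)) pp.
  by rewrite mem_index_iota; apply: leq_ltn_trans (dvdn_leq m0 pm) mN.
by apply/implyP => _; apply: dvdn_leq_log.
Qed.

Lemma triple_weightE h a b c N : (0 < h)%N -> (0 < a)%N -> (0 < b)%N -> (0 < c)%N ->
  (a * b * c < N)%N ->
  triple_weight (divisor_steps h) N a b c =
  INR (compatible h a b c) * / INR (lcm3 a b c).
Proof.
move=> h0 a0 b0 c0 abcN; rewrite /triple_weight.
have abc0 : (0 < a * b * c)%N by rewrite !muln_gt0 a0 b0.
have a_abc : a %| a * b * c by rewrite -mulnA dvdn_mulr.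
have b_abc : b %| a * b * c by rewrite -mulnA mulnCA dvdn_mulr.
have c_abc : c %| a * b * c by rewrite dvdn_mull.
have small m : m %| a * b * c -> (0 < m < N)%N.
  move=> dvd_m; rewrite (dvdn_gt0 abc0 dvd_m).
  exact: leq_ltn_trans (dvdn_leq abc0 dvd_m) abcN.
rewrite (@eq_primeprod _ (fun p =>
    INR (logn p (gcdn a b) <= logn p h)%N * INR (logn p (gcdn a c) <= logn p h)%N *
    INR (logn p (gcdn b c) <= logn p (2 * h))%N * / (INR p ^ logn p (lcm3 a b c)) *
    (INR p ^ logn p a * INR p ^ logn p b * INR p ^ logn p c))); last first.
  move=> p pp _; rewrite /divisor_steps step_fun3_local_steps // /local_weight.
  rewrite /local_compatible !INR_andb !logn_gcd // lognM // logn_lcm3 //.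
  by rewrite -!pow_inv !Rinv_inv !pow_add; ring.
rewrite !big_split -(big_morph Rinv Rinv_mult Rinv_1) /=.
rewrite !primeprod_logn_le ?primeprod_logn ?muln_gt0 //; try apply: small => //.
- rewrite /compatible !INR_andb; field.
  by do !split; apply: INR_neq0 => //; apply: lcm3_gt0.
- by rewrite !dvdn_lcm a_abc b_abc.
- exact: dvdn_trans (dvdn_gcdr _ _) c_abc.
- exact: dvdn_trans (dvdn_gcdr _ _) c_abc.
- exact: dvdn_trans (dvdn_gcdr _ _) b_abc.
Qed.

(** * Counting the triples of divisors *)

Lemma chinese_noncoprime m n u v : (0 < m)%N -> (0 < n)%N -> u = v %[mod gcdn m n] ->
  exists z, z = u %[mod m] /\ z = v %[mod n].
Proof.
move=> m0 n0 uv; have [a _ n_dvd] := Bezoutr m n0.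
pose u' := (u + m * v)%N.
have vu' : (v <= u')%N by rewrite /u'; nia.
have gu' : gcdn m n %| u' - v.
  rewrite -eqn_mod_dvd // /u' -uv; apply/eqP.
  by rewrite -modnDmr; have /eqP -> := dvdn_mulr v (dvdn_gcdl m n); rewrite addn0.
exists (u' + m * (a * ((u' - v) %/ gcdn m n)))%N; split.
  by rewrite /u' -addnA -mulnDr addnC mulnC modnMDl.
apply/eqP; rewrite eqn_mod_dvd; last by apply: leq_trans vu' (leq_addr _ _).
have -> : (u' + m * (a * ((u' - v) %/ gcdn m n)) - v =
           ((u' - v) %/ gcdn m n) * (gcdn m n + a * m))%N.
  by rewrite -addnBAC // -{1}(divnK gu') mulnDr; congr (_ + _)%N; rewrite mulnC -mulnA mulnCA.
exact: dvdn_mull.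
Qed.

Lemma modn_eq_dvd d m u v : d %| m -> u = v %[mod m] -> u = v %[mod d].
Proof. by move=> dm uv; rewrite -(modn_dvdm u dm) uv modn_dvdm. Qed.

Lemma divn_le_sum_eqmod m r X : (0 < m)%N ->
  (X %/ m <= \sum_(0 <= n < X) (n == r %[mod m]))%N.
Proof.
move=> m0; have block_le q : (q <= \sum_(0 <= n < q * m) (n == r %[mod m]))%N.
  elim: q => [//|q IH].
  rewrite (@big_cat_nat _ _ _ (q * m)) //=; last by nia.
  have mem : (q * m + r %% m)%N \in index_iota (q * m) (q.+1 * m).
    by rewrite mem_index_iota; have := ltn_pmod r m0; lia.
  rewrite [X in (_ + X)%N](bigD1_seq _ mem (iota_uniq _ _)) /=.
  by rewrite modnMDl modn_mod eqxx; lia.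
apply: leq_trans (block_le (X %/ m)%N) _.
by rewrite [X in (_ <= X)%N](@big_cat_nat _ _ _ (X %/ m * m)) ?leq_addr // leq_divM.
Qed.

Section DivisorTriples.
Variables h a b c : nat.
Hypotheses (h0 : (0 < h)%N) (a0 : (0 < a)%N) (b0 : (0 < b)%N) (c0 : (0 < c)%N).

Definition divisor_triple (n : nat) : bool := [&& a %| n, b %| n - h & c %| n + h].

Definition triple_count (X : nat) : nat := \sum_(h.+1 <= n < X.+1) divisor_triple n.

Lemma exists_divisor_triple_residue : compatible h a b c ->
  exists z, [/\ a %| z, z = h %[mod b] & c %| z + h].
Proof.
case/and3P=> ab ac bc.
have [z1 [z1_0 z1b]] : exists z, z = 0 %[mod a] /\ z = h %[mod b].
  by apply: chinese_noncoprime => //; rewrite mod0n; apply/esym/eqP.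
have z1a : a %| z1 by rewrite /dvdn z1_0 mod0n.
have h_mul_c : (h * c.-1 + h = h * c)%N by rewrite -mulnSr prednK.
have [z [z_z1 z_h]] : exists z, z = z1 %[mod lcmn a b] /\ z = h * c.-1 %[mod c].
  apply: chinese_noncoprime; rewrite ?lcmn_gt0 ?a0 ?b0 //; apply/eqP.
  rewrite -(eqn_modDr h) h_mul_c Order.NatDvd.meetUl.
  have /eqP -> : lcmn (gcdn a c) (gcdn b c) %| h * c.
    by apply: dvdn_mull; rewrite dvdn_lcm !dvdn_gcdr.
  rewrite -/(dvdn _ _) dvdn_lcm; apply/andP; split.
    by apply: dvdn_add ac; apply: dvdn_trans (dvdn_gcdl _ _) z1a.
  have /eqP : z1 + h = 2 * h %[mod gcdn b c].
    by rewrite mul2n -addnn; apply/eqP; rewrite eqn_modDr (modn_eq_dvd (dvdn_gcdl b c) z1b).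
  by rewrite /dvdn => /eqP ->.
exists z; split.
- by rewrite /dvdn (modn_eq_dvd (dvdn_lcml a b) z_z1).
- by rewrite (modn_eq_dvd (dvdn_lcmr a b) z_z1).
by rewrite /dvdn -modnDml z_h modnDml h_mul_c modnMl.
Qed.

Lemma divisor_triple_eqmod z n : [/\ a %| z, z = h %[mod b] & c %| z + h] ->
  (h < n)%N -> n = z %[mod lcm3 a b c] -> divisor_triple n.
Proof.
move=> [za zb zc] hn nz; have ab_lcm : lcmn a b %| lcm3 a b c by apply: dvdn_lcml.
rewrite /divisor_triple -eqn_mod_dvd ?(ltnW hn) // /dvdn -modnDml.
rewrite (modn_eq_dvd (dvdn_trans (dvdn_lcml a b) ab_lcm) nz) (eqP za) eqxx.
rewrite (modn_eq_dvd (dvdn_trans (dvdn_lcmr a b) ab_lcm) nz) zb eqxx.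
by rewrite (modn_eq_dvd (dvdn_lcmr (lcmn a b) c) nz) modnDml.
Qed.

Lemma divn_lcm3_le_triple_count X : compatible h a b c ->
  (X %/ lcm3 a b c <= triple_count X + h.+1)%N.
Proof.
move=> /exists_divisor_triple_residue[z z_sol].
apply: leq_trans (divn_le_sum_eqmod z X (lcm3_gt0 a0 b0 c0)) _.
have sum_le n : (\sum_(0 <= i < n) (i == z %[mod lcm3 a b c]) <= n)%N.
  rewrite -[leqRHS]muln1 -[n in leqRHS]subn0 -sum_nat_const_nat; apply: leq_sum => i _.
  exact: leq_b1.
have [hX|hX] := leqP X h.+1; first by apply: leq_trans (sum_le _) _; lia.
rewrite (@big_cat_nat _ _ _ h.+1) //= ?(ltnW hX) // addnC; apply: leq_add => //.
rewrite /triple_count big_nat_recr ?(ltnW hX) //=; apply: leq_trans _ (leq_addr _ _).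
rewrite [leqLHS]big_nat_cond [leqRHS]big_nat_cond; apply: leq_sum => n /andP[/andP[hn _] _].
by case: eqP => //= n_z; rewrite (divisor_triple_eqmod z_sol hn n_z).
Qed.

Lemma mul_weight_le_triple_count X x : 0 <= x < INR X + 1 ->
  x * (INR (compatible h a b c) * / INR (lcm3 a b c)) <= INR (triple_count X) + (INR h + 2).
Proof.
move=> [x0 xX]; have count0 := pos_INR (triple_count X); have INRh0 := pos_INR h.
have [cpt|_] := boolP (compatible h a b c); last by rewrite /= Rmult_0_l Rmult_0_r; lra.
have lcm_gt0 := lcm3_gt0 a0 b0 c0; rewrite Rmult_1_l.
apply/Rle_div_l; first exact: INR_gt0.
have /leP/le_INR := divn_lcm3_le_triple_count X cpt; rewrite plus_INR S_INR => count_ge.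
have /leP/le_INR := ltn_ceil X lcm_gt0; rewrite mult_INR !S_INR => X_lt.
apply: Rle_trans (_ : INR X + 1 <= _); first by lra.
apply: Rle_trans X_lt _; apply: Rmult_le_compat_r; first exact: pos_INR.
by lra.
Qed.

End DivisorTriples.

Lemma rsum_dvdn_le_dnum y m : (0 < m)%N -> \rsum_(1 <= a < y.+1) INR (a %| m) <= INR (dnum m).
Proof.
move=> m0; rewrite -INR_sum; apply: le_INR; apply/leP.
rewrite -big_mkcond sum1_count -size_filter; apply: uniq_leq_size.
  by apply: filter_uniq; apply: iota_uniq.
by move=> a; rewrite mem_filter -dvdn_divisors // => /andP[].
Qed.

Lemma sum_above_le_Ssum h x :
  (\sum_(h.+1 <= n < (Z.to_nat (Int_part x)).+1) dnum n * dnum (n - h) * dnum (n + h)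
     <= Ssum h x)%N.
Proof.
rewrite /Ssum; set X := Z.to_nat _; have [hX|hX] := leqP h X; last by rewrite big_geq //; lia.
rewrite [leqRHS](@big_cat_nat _ _ _ h.+1) //=; apply: leq_trans (leq_addl _ _).
rewrite big_nat_cond [leqRHS]big_nat_cond.
rewrite [leqRHS](eq_bigl (fun n => (h < n < X.+1)%N && true)); last by move=> n; lia.
apply: leq_sum => n /andP[/andP[hn _] _].
by have -> : (n - h + (h - n) = n - h)%N by lia.
Qed.

Lemma sum3_triple_count_le_Ssum h y x :
  sum3 y y y (fun a b c => INR (triple_count h a b c (Z.to_nat (Int_part x)))) <= INR (Ssum h x).
Proof.
apply: Rle_trans (le_INR _ _ (leP (sum_above_le_Ssum h x))); set X := Z.to_nat _.
under eq_sum3 do rewrite INR_sum.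
rewrite sum3_rsum INR_sum; apply: rsum_le => n; rewrite mem_index_iota => /andP[hn _].
under eq_sum3 do rewrite /divisor_triple !INR_andb -Rmult_assoc.
rewrite sum3_mul !mult_INR.
have sum_ge0 m : 0 <= \rsum_(1 <= a < y.+1) INR (a %| m) by apply: rsum_ge0 => a; apply: pos_INR.
apply: Rmult_le_compat => //; [by apply: Rmult_le_pos | | by apply: rsum_dvdn_le_dnum; lia].
by apply: Rmult_le_compat => //; apply: rsum_dvdn_le_dnum; lia.
Qed.

(** * The error factors and the constant *)

Lemma inv_sqrt3_le_telescope n : (0 < n)%N ->
  / sqrt (INR n.+1) ^ 3 <= 2 * (/ sqrt (INR n) - / sqrt (INR n.+1)).
Proof.
move=> n0; have N0 := INR_gt0 n0; have a0 := sqrt_lt_R0 _ N0.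
have ab : sqrt (INR n) <= sqrt (INR n.+1) by apply: sqrt_le_1_alt; rewrite S_INR; lra.
have : sqrt (INR n.+1) ^ 2 = sqrt (INR n) ^ 2 + 1.
  by rewrite !pow2_sqrt ?S_INR //; lra.
move: (sqrt (INR n)) (sqrt (INR n.+1)) a0 ab => a b a0 ab b2.
have -> : / b ^ 3 = a * (a + b) / (a * b ^ 3 * (a + b)) by field; lra.
have -> : 2 * (/ a - / b) = 2 * (b ^ 2 - a ^ 2) * b ^ 2 / (a * b ^ 3 * (a + b)) by field; lra.
apply: Rmult_le_compat_r; last by nra.
by left; apply: Rinv_0_lt_compat; repeat apply: Rmult_lt_0_compat; lra.
Qed.

Lemma root4_ratio_sqr p : (0 < p)%N -> (root4 p / INR p) ^ 2 = / sqrt (INR p) ^ 3.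
Proof.
move=> /INR_gt0 p0; have s0 := sqrt_lt_R0 _ p0.
rewrite /Rdiv Rpow_mult_distr /root4 pow2_sqrt; last by lra.
rewrite -[INR p in X in _ * X](pow2_sqrt (INR p)); last by lra.
by field; lra.
Qed.

Lemma root4_ratio_bounds p : (0 < p)%N -> 0 <= root4 p / INR p <= 1.
Proof.
move=> p0; have p_gt0 := INR_gt0 p0; have r1 := root4_ge1 p0; split.
  by apply: Rdiv_le_0_compat; lra.
apply: (proj1 (Rdiv_le_1 _ _ p_gt0)); rewrite -root4_pow4 -{1}[root4 p]pow_1.
by apply: Rle_pow => //; lia.
Qed.

Lemma divisor_steps_coprime h p : (0 < h)%N -> (2 * h < p)%N ->
  divisor_steps h p = coprime_steps.
Proof.
move=> h0 hp; rewrite /divisor_steps /local_steps.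
have -> : (p == 2%N) = false by lia.
by rewrite ltn_log0 //; lia.
Qed.

Lemma mass3_labs_divisor_steps_le h p : (0 < h)%N -> (2 * h < p)%N ->
  mass3 (root4 p / INR p) (labs (divisor_steps h p)) <=
  1 + (10 / sqrt (INR p.-1) - 10 / sqrt (INR p)).
Proof.
move=> h0 hp; have p0 : (0 < p)%N by lia.
rewrite divisor_steps_coprime //; apply: Rle_trans (mass3_labs_coprime_steps _) _.
  exact: root4_ratio_bounds.
case: p p0 hp => // p _ hp; rewrite root4_ratio_sqr // -pred_Sn.
by have := @inv_sqrt3_le_telescope p ltac:(lia); rewrite /Rdiv; lra.
Qed.

Lemma triple_error_bounded h : (0 < h)%N ->
  exists E, 0 <= E /\ forall N, (2 * h < N)%N -> triple_error (divisor_steps h) N <= E.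
Proof.
move=> h0; pose g p := 10 / sqrt (INR p.-1).
have error_ge0 p : prime p -> 0 <= mass3 (root4 p / INR p) (labs (divisor_steps h p)).
  move=> pp; apply: mass3_labs_ge0; apply: Rmult_le_pos; first exact: root4_ge0.
  by have [] := inv_prime_le_half pp; lra.
exists (triple_error (divisor_steps h) (2 * h).+1 * exp (g (2 * h).+1)); split.
  by apply: Rmult_le_pos; [apply: primeprod_ge0 | left; apply: exp_pos].
move=> N hN; apply: Rle_trans (primeprod_le_exp (g := g) hN error_ge0 _ _) _.
- case=> [|[|p]] // hp; first by lia.
  apply: Rmult_le_compat_l; first by lra.
  apply: Rinv_le_contravar; first by apply: sqrt_lt_R0; apply: INR_gt0.
  by apply: sqrt_le_1_alt; apply: le_INR; lia.
- by move=> p _ hp; apply: mass3_labs_divisor_steps_le.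
apply: Rmult_le_compat_l; first exact: primeprod_ge0.
left; apply: exp_increasing; suff : 0 < g N by lra.
apply: Rdiv_lt_0_compat; first by lra.
by apply: sqrt_lt_R0; apply: INR_gt0; lia.
Qed.

Lemma euler_partial_decr n : 0 <= euler_partial n.+1 <= euler_partial n.
Proof.
have ge0 m : 0 <= euler_partial m.
  by apply: primeprod_ge0 => p /euler_factor_bounds[factor_gt0 _]; left.
split=> //; rewrite /euler_partial primeprodS -/(euler_partial n) -/(euler_factor n).
case: ifP => [/euler_factor_bounds[_ factor_le1]|_]; last by lra.
by have := Rmult_le_compat_l _ _ _ (ge0 n) factor_le1; lra.
Qed.

Lemma euler_prod_bounds n : 0 <= euler_prod <= euler_partial n.
Proof.
have decr m : euler_partial m.+1 <= euler_partial m by have [] := euler_partial_decr m.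
have ge0 m : 0 <= euler_partial m by apply: Rle_trans (decr m); have [] := euler_partial_decr m.
have [l cvg_l] := ex_finite_lim_seq_decr euler_partial 0 decr ge0.
have -> : euler_prod = l by rewrite /euler_prod (is_lim_seq_unique _ _ cvg_l).
split; last exact: is_lim_seq_decr_compare cvg_l decr n.
exact: (is_lim_seq_le (fun=> 0) euler_partial 0 l ge0 (is_lim_seq_const 0) cvg_l).
Qed.

Lemma triple_massE h N : (0 < h)%N -> (2 * h < N)%N ->
  triple_mass (divisor_steps h) N = 11 / 8 * fmul h * euler_partial N.
Proof.
move=> h0 hN; rewrite /triple_mass.
rewrite (eq_primeprod (fun p pp _ => mass3_local_steps (logn p h) pp)) big_split /=.
congr (_ * _); rewrite big_split /=; congr (_ * _).
  rewrite (@primeprod_widen _ 3) //; [|by lia|].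
    by rewrite !primeprodS big_geq //=; lra.
  by move=> p _ p3; rewrite gtn_eqF.
apply: primeprod_widen; first by lia.
by move=> p _ hp; rewrite /fpp ltn_log0.
Qed.

Lemma c_h_bounds h N : (0 < h)%N -> (2 * h < N)%N ->
  0 <= c_h h <= triple_mass (divisor_steps h) N.
Proof.
move=> h0 hN; have fmul_ge0 : 0 <= 11 / 8 * fmul h.
  by apply: Rmult_le_pos; [lra | apply: primeprod_ge0 => p; apply: fpp_ge0].
have [euler0 euler_le] := euler_prod_bounds N.
by rewrite triple_massE //; split; [apply: Rmult_le_pos | apply: Rmult_le_compat_l].
Qed.

Lemma lt_INR_Int_part x : x < INR (Z.to_nat (Int_part x)) + 1.
Proof.
have [_ x_lt] := Zfloor_bound x; apply: Rlt_le_trans x_lt _; apply: Rplus_le_compat_r.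
by rewrite INR_IZR_INZ; apply: IZR_le; rewrite /Zfloor -/(Int_part x); lia.
Qed.

Lemma Ssum_ge_triple_sum h y N x : (0 < h)%N -> (y ^ 3 < N)%N -> 0 <= x ->
  x * triple_sum (divisor_steps h) N y y y - (INR h + 2) * INR y ^ 3 <= INR (Ssum h x).
Proof.
move=> h0 yN x0; apply: Rle_trans (sum3_triple_count_le_Ssum h y x).
have -> : (INR h + 2) * INR y ^ 3 = sum3 y y y (fun _ _ _ => INR h + 2) by rewrite sum3_cst; ring.
apply/Rle_minus_l; rewrite /triple_sum -sum3_scale -sum3_add; apply: sum3_le => a b c.
move=> /andP[a0 ay] /andP[b0 b_y] /andP[c0 cy]; rewrite triple_weightE //.
  by apply: mul_weight_le_triple_count => //; split=> //; apply: lt_INR_Int_part.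
by apply: leq_ltn_trans yN; rewrite !expnS expn0 muln1 mulnA; do !apply: leq_mul.
Qed.

Lemma triple_sum_ge_ln3 h : (0 < h)%N -> exists E, 0 <= E /\
  forall y N, (0 < y)%N -> (2 * h < N)%N ->
  c_h h * ln (INR y) ^ 3 - E * (1 + ln (INR y)) ^ 2 <= triple_sum (divisor_steps h) N y y y.
Proof.
move=> h0; have [E [E0 error_le]] := triple_error_bounded h0.
exists (12 * E); split=> [|y N y0 hN]; first by lra.
have ly := ln_INR_ge0 y0; have [_ c_le] := c_h_bounds h0 hN.
have := @triple_sum_approx (divisor_steps h) N y 1 1 1 y0 isT isT isT.
have -> : root4 1 = 1 by rewrite /root4 /= !sqrt_1.
rewrite !divn1 !Rmult_1_r => approx.
have main : c_h h * ln (INR y) ^ 3 <= triple_mass (divisor_steps h) N * ln (INR y) ^ 3.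
  by apply: Rmult_le_compat_r => //; apply: pow_le.
have error : 12 * triple_error (divisor_steps h) N * (1 + ln (INR y)) ^ 2 <=
    12 * E * (1 + ln (INR y)) ^ 2.
  apply: Rmult_le_compat_r; first by apply: pow_le; lra.
  by have := error_le N hN; lra.
by move: approx; split_Rabs; lra.
Qed.

Lemma exists_cube_le x : 1 <= x -> exists y : nat,
  [/\ (0 < y)%N, INR y ^ 3 <= x & ln x / 3 - 1 <= ln (INR y) <= ln x / 3].
Proof.
move=> x1; have lx0 : 0 <= ln x by rewrite -ln_1; apply: ln_le; lra.
pose r := exp (ln x / 3); have r1 : 1 <= r by have := exp_ineq1_le (ln x / 3); rewrite -/r; lra.
have r3 : r ^ 3 = x.
  rewrite -[RHS]exp_ln; last by lra.
  by rewrite [ln x in RHS](_ : _ = ln x / 3 + (ln x / 3 + ln x / 3)) ?exp_plus -/r; [ring | field].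
have [y [y_le y_gt]] := nfloor_ex r ltac:(lra).
have y0 : (0 < y)%N by apply/ltP/INR_lt; rewrite /=; lra.
have Y1 := INR_ge1 y0; exists y; split=> //.
  by rewrite -r3; apply: pow_incr; lra.
have ln_r : ln r = ln x / 3 by apply: ln_exp.
split; last by rewrite -ln_r; apply: ln_le; lra.
have : ln (r / 2) <= ln (INR y) by apply: ln_le; lra.
by rewrite ln_div ?ln_r; try lra; have := @ln_le_sub1 2 ltac:(lra); lra.
Qed.

Lemma cubic_lower_bound c E l m : 0 <= c -> 0 <= E -> 3 <= l -> l / 3 - 1 <= m <= l / 3 ->
  c / 27 * l ^ 3 - (c / 3 + E) * l ^ 2 <= c * m ^ 3 - E * (1 + m) ^ 2.
Proof.
move=> c0 E0 l3 [m_ge m_le].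
have cube_le : c * (l ^ 3 / 27 - l ^ 2 / 3) <= c * m ^ 3.
  by apply: Rmult_le_compat_l => //; apply: Rle_trans (pow_incr (l / 3 - 1) m 3 _); [nra | lra].
have square_le : E * (1 + m) ^ 2 <= E * l ^ 2.
  by apply: Rmult_le_compat_l => //; apply: pow_incr; lra.
by lra.
Qed.

Theorem theorem1p1 (h : nat) (hpos : (0 < h)%N) :
  exists (C X0 : R), forall x : R, (X0 <= x)%R ->
    (c_h h / 27 * x * ln x ^ 3 - C * x * ln x ^ 2 <= INR (Ssum h x))%R.
Proof.
have [E [E0 sum_ge]] := triple_sum_ge_ln3 hpos.
have [c0 _] := c_h_bounds hpos (ltnSn (2 * h)).
exists (c_h h / 3 + E + (INR h + 2)), (exp 3) => x x_ge.
have x1 : 1 <= x by have := exp_ineq1_le 3; lra.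
have l3 : 3 <= ln x by rewrite -(ln_exp 3); apply: ln_le => //; apply: exp_pos.
have [y [y0 y3_le lny]] := exists_cube_le x1; pose N := (y ^ 3 + 2 * h).+1.
have hN : (2 * h < N)%N by rewrite /N; lia.
have yN : (y ^ 3 < N)%N by rewrite /N; lia.
apply: Rle_trans (Ssum_ge_triple_sum hpos yN _); last by lra.
have sum_bound := Rle_trans _ _ _ (cubic_lower_bound c0 E0 l3 lny) (sum_ge y N y0 hN).
have main_term : x * (c_h h / 27 * ln x ^ 3 - (c_h h / 3 + E) * ln x ^ 2) <=
    x * triple_sum (divisor_steps h) N y y y by apply: Rmult_le_compat_l; lra.
have counting_error : (INR h + 2) * INR y ^ 3 <= (INR h + 2) * (x * ln x ^ 2).
  by apply: Rmult_le_compat_l; [have := pos_INR h; lra | have : 1 <= ln x ^ 2; nra].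
by lra.
Qed.
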